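(* Let $R$ be a domain and $S$ a multiplicatively closed subset of $R$. For $(s,r)\in S\times R$ let $\varphi_{s,r}:R\to R/Rs$, $x\mapsto xr+Rs$, which is a homomorphism of left $R$-modules. Then the following are equivalent: (1) $S$ satisfies the left Ore condition in $R$; (2) for all $(s,r)\in S\times R$, $\ker(\varphi_{s,r})\cap S\neq\emptyset$.
   Context: Rings are unital and not necessarily commutative; a domain is a nonzero ring without zero divisors. A subset $S\subseteq R$ is multiplicatively closed if $1\in S$, $0\notin S$ and $st\in S$ for all $s,t\in S$. A subset $S\subseteq R$ satisfies the left Ore condition in $R$ if for all $s\in S$ and $r\in R$ there exist $\tilde s\in S$ and $\tilde r\in R$ with $\tilde s r=\tilde r s$. *)

(* Defs.v *)
From HB Require Import structures.
From mathcomp Require Import all_boot all_algebra.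
From mathcomp Require Import boolp classical_sets.

Set Implicit Arguments.
Unset Strict Implicit.
Unset Printing Implicit Defensive.

Import GRing.Theory.
Local Open Scope classical_set_scope.
Local Open Scope quotient_scope.
Local Open Scope ring_scope.

(* MathComp only provides V / I as an abelian group (Quotient.quot); the alias
   lmod_quot I adds the action a *: \pi v = \pi (a *: v). *)
Section LmodQuotient.
Variables (R : nzRingType) (V : lmodType R) (I : submodClosed V).

(* A submodClosed is not canonically a zmodClosed over a ring: its class is
   defined over semirings and does not record closure under opposites. *)
Definition submod_pred : {pred V} := fun v => v \in I.

HB.instance Definition _ := GRing.isZmodClosed.Build V submod_pred
  (GRing.submod_closedB (submodClosedP I)).

Definition lmod_quot := Quotient.quot submod_pred.

HB.instance Definition _ := GRing.Zmodule.on lmod_quot.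
HB.instance Definition _ := ZmodQuotient.on lmod_quot.

Definition lmod_quot_scale (a : R) (q : lmod_quot) : lmod_quot :=
  \pi_lmod_quot (a *: repr q).

Lemma lmod_quot_pi_scale (a : R) (v : V) :
  lmod_quot_scale a (\pi_lmod_quot v) = \pi_lmod_quot (a *: v).
Proof.
apply/eqP; rewrite /lmod_quot_scale -Quotient.idealrBE -scalerBr.
apply: (@rpredZ _ _ I); change (repr (\pi_lmod_quot v) - v \in submod_pred).
by rewrite Quotient.idealrBE reprK.
Qed.

Lemma lmod_quot_scaleA a b v :
  lmod_quot_scale a (lmod_quot_scale b v) = lmod_quot_scale (a * b) v.
Proof. by rewrite -[v]reprK (lmod_quot_pi_scale b) !lmod_quot_pi_scale scalerA. Qed.

Lemma lmod_quot_scale1 : left_id 1 lmod_quot_scale.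
Proof. by move=> v; rewrite -[v]reprK lmod_quot_pi_scale scale1r. Qed.

Lemma lmod_quot_scaleDr : right_distributive lmod_quot_scale +%R.
Proof.
move=> a u v; rewrite -[u]reprK -[v]reprK -raddfD.
by rewrite !lmod_quot_pi_scale scalerDr raddfD.
Qed.

Lemma lmod_quot_scaleDl v : {morph lmod_quot_scale^~ v : a b / a + b}.
Proof.
by move=> a b; rewrite -[v]reprK !lmod_quot_pi_scale scalerDl raddfD.
Qed.

HB.instance Definition _ := GRing.Zmodule_isLmodule.Build R lmod_quot
  lmod_quot_scaleA lmod_quot_scale1 lmod_quot_scaleDr lmod_quot_scaleDl.

Lemma lmod_quot_pi_is_linear : linear \pi_lmod_quot.
Proof.
by move=> a u v; rewrite raddfD; congr (_ + _); rewrite -[LHS]lmod_quot_pi_scale.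
Qed.

End LmodQuotient.

Section PrincipalLeftIdeal.
Variables (R : nzRingType) (s : R).

(* The left ideal R s, as a submodule of the left R-module R^o. *)
Definition plideal : {pred R^o} := fun x => `[< exists a : R, x = a * s >].

Lemma plideal_submod_closed : submod_closed plideal.
Proof.
split; first by apply/asboolP; exists 0; rewrite mul0r.
move=> a _ _ /asboolP[b ->] /asboolP[c ->]; apply/asboolP.
by exists (a * b + c); rewrite mulrDl -mulrA.
Qed.

HB.instance Definition _ :=
  GRing.isSubmodClosed.Build R R^o plideal plideal_submod_closed.

End PrincipalLeftIdeal.

Section Phi.
Variables (R : nzRingType) (s r : R).

Definition phi (x : R^o) : lmod_quot (plideal s) := \pi_(lmod_quot (plideal s)) (x * r).

Lemma phi_is_linear : linear phi.
Proof.
by move=> a x y; rewrite /phi -lmod_quot_pi_is_linear mulrDl scalerAl.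
Qed.

HB.instance Definition _ :=
  GRing.isLinear.Build R R^o (lmod_quot (plideal s)) *:%R phi phi_is_linear.

End Phi.

Definition lmod_ker (R : nzRingType) (U V : lmodType R)
  (f : {linear U -> V}) : set U := [set x | f x = 0].

Definition mult_closed (R : nzRingType) (S : set R) : Prop :=
  [/\ S 1, ~ S 0 & forall s t : R, S s -> S t -> S (s * t)].

Definition left_Ore (R : nzRingType) (S : set R) : Prop :=
  forall s r : R, S s -> exists s' r' : R, S s' /\ s' * r = r' * s.

(* Main.v *)
(* The kernel of [phi s r] consists of the x with [x r] in [R s], so an element
   of it in S is exactly a left Ore multiplier for the pair (s, r). *)
Require Import Defs.
From HB Require Import structures.
From mathcomp Require Import all_boot all_algebra.
From mathcomp Require Import boolp classical_sets.
Local Open Scope classical_set_scope.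
Local Open Scope ring_scope.

(** The equation [s' * r = r' * s] for some [r'] means that [s' * r] has zero class modulo [R s], so
    the Ore multipliers of [(s, r)] are the elements of [S] in the kernel of [phi s r]. The two
    conditions thus agree pair by pair, through [lmod_ker_phiP]. *)

Lemma lmod_quot_pi_eq0 (R : nzRingType) (V : lmodType R) (I : submodClosed V)
    (v : V) :
  (\pi_(lmod_quot I) v == 0 :> lmod_quot I)%qT = (v \in I).
Proof.
(* [Quotient.idealrBE] speaks of differences and of the predicate [submod_pred I] underlying the
   quotient, hence [v - 0] and the change of predicate. *)
rewrite -[v in RHS]GRing.subr0 -[RHS]/(v - 0 \in submod_pred I).
by rewrite Quotient.idealrBE GRing.raddf0.
Qed.

Lemma lmod_ker_phiP (R : nzRingType) (s r x : R) :
  lmod_ker (phi s r) x <-> exists a : R, x * r = a * s.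
Proof.
split=> [/eqP|xr]; last apply/eqP.
  by rewrite lmod_quot_pi_eq0 => /asboolP.
by rewrite lmod_quot_pi_eq0; apply/asboolP.
Qed.

Theorem proposition3p2 (R : nzRingType)
    (domR : forall x y : R, x * y = 0 -> x = 0 \/ y = 0)
    (S : set R) (mulS : mult_closed S) :
  left_Ore S <->
  (forall s r : R, S s -> lmod_ker (phi s r) `&` S !=set0).
Proof.
split=> [oreS s r Ss|kerS s r Ss].
  have [s' [r' [Ss' eq_sr]]] := oreS s r Ss.
  by exists s'; split=> //; apply/lmod_ker_phiP; exists r'.
by have [s' [/lmod_ker_phiP[r' eq_sr] Ss']] := kerS s r Ss; exists s', r'.
Qed.
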